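(* The equation $(x^4+y^4)\frac{m^4+1}{2}=z^4+w^4$, where $m$ is an arbitrary odd integer, has infinitely many parametric solutions. That is, there exist infinitely many pairwise non-proportional quadruples $(x,y,z,w)\neq(0,0,0,0)$ of polynomials in $\mathbb{Z}[m]$ such that, for all odd integers $m$, $$\bigl(x(m)^4+y(m)^4\bigr)\,\frac{m^4+1}{2}=z(m)^4+w(m)^4 .$$
   Context: A parametric solution of the equation is a quadruple $(x,y,z,w)$ of polynomials with integer coefficients in the parameter $m$, not all zero, satisfying the equation identically in the parameter. Two quadruples $(x,y,z,w)$ and $(x',y',z',w')$ are proportional if there is a nonzero $\lambda\in\mathbb{Q}(m)$ with $(x',y',z',w')=(\lambda x,\lambda y,\lambda z,\lambda w)$; proportional quadruples are counted as the same solution. *)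

(* Defs.v *)
From HB Require Import structures.
From mathcomp Require Import all_boot all_order all_algebra.

Set Implicit Arguments.
Unset Strict Implicit.
Unset Printing Implicit Defensive.

Import GRing.Theory.
Local Open Scope ring_scope.

Record quadruple := Quadruple {
  qx : {poly int}; qy : {poly int}; qz : {poly int}; qw : {poly int}
}.

(* The division by 2 takes place in rat, so it is not truncated. *)
Definition quartic_equation (m x y z w : int) : Prop :=
  (x ^+ 4 + y ^+ 4)%:Q * ((m ^+ 4 + 1)%:Q / 2) = (z ^+ 4 + w ^+ 4)%:Q.

Definition parametric_solution (q : quadruple) : Prop :=
  q <> Quadruple 0 0 0 0 /\
  forall m : int, ~~ (2 %| m)%Z ->
    quartic_equation m (qx q).[m] (qy q).[m] (qz q).[m] (qw q).[m].

(* The embedding of Z[m] into Q(m), the latter built as the field of fractions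
   of Q[m]. *)
Definition toQm (p : {poly int}) : {fraction {poly rat}} :=
  FracField.tofrac (map_poly (intr : int -> rat) p).

Definition proportional (q q' : quadruple) : Prop :=
  exists lambda : {fraction {poly rat}},
    [/\ lambda != 0,
        toQm (qx q') = lambda * toQm (qx q),
        toQm (qy q') = lambda * toQm (qy q),
        toQm (qz q') = lambda * toQm (qz q) &
        toQm (qw q') = lambda * toQm (qw q)].

(* Main.v *)
Require Import Defs.
From mathcomp Require Import all_boot all_order all_algebra.
From mathcomp Require Import ring.

Set Implicit Arguments.
Unset Strict Implicit.
Unset Printing Implicit Defensive.

Import Order.TTheory GRing.Theory Num.Theory.
Local Open Scope ring_scope.

(** Put a = m^2 + 1 and b = m^2 - 1, so that a^2 + b^2 = 2 (m^4 + 1). The genus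
    one curve (m^4 + 1) x^2 = b z^2 + a w^2, (m^4 + 1) y^2 = a z^2 - b w^2 lies
    on the surface, contains (1, 1, m, 1), and is parametrised by Jacobi's
    functions, z : x : y : w being sn : cn : dn : 1 up to constants, with
    k^2 = - a^2 / b^2. The classical formulas for sn 3u, cn 3u, dn 3u give a
    rational self-map of the curve. At m = 3 it maps the 3-adic disc z = 0 mod 3
    to itself and multiplies z / w there by 3 times a unit; hence the iterates
    of (1, 1, m, 1) have distinct 3-adic valuations of z / w at m = 3. *)

Section Triplication.

Variable R : comNzRingType.
Implicit Types a b c m x y z w Z W : R.

(* With s = - b Z / (a W) for sn^2 u and k^2 = - a^2 / b^2, the four forms below
   are a b W^4 times sn 3u / sn u, cn 3u / cn u, dn 3u / dn u and 1, all
   multiplied by 1 - 6 k^2 s^2 + 4 k^2 (1 + k^2) s^3 - 3 k^4 s^4. *)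
Definition sn_factor a b Z W :=
  3 * a * b * W ^+ 4 + 4 * (b ^+ 2 - a ^+ 2) * Z * W ^+ 3
  - 6 * a * b * Z ^+ 2 * W ^+ 2 - a * b * Z ^+ 4.

Definition cn_factor a b Z W :=
  a * b * W ^+ 4 + 4 * b ^+ 2 * Z * W ^+ 3 - 6 * a * b * Z ^+ 2 * W ^+ 2
  + 4 * a ^+ 2 * Z ^+ 3 * W + a * b * Z ^+ 4.

Definition dn_factor a b Z W :=
  a * b * W ^+ 4 - 4 * a ^+ 2 * Z * W ^+ 3 - 6 * a * b * Z ^+ 2 * W ^+ 2
  - 4 * b ^+ 2 * Z ^+ 3 * W + a * b * Z ^+ 4.

Definition den_factor a b Z W :=
  a * b * W ^+ 4 + 6 * a * b * Z ^+ 2 * W ^+ 2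
  + 4 * (b ^+ 2 - a ^+ 2) * Z ^+ 3 * W - 3 * a * b * Z ^+ 4.

Definition on_curve a b c x y z w :=
  c * x ^+ 2 = b * z ^+ 2 + a * w ^+ 2 /\ c * y ^+ 2 = a * z ^+ 2 - b * w ^+ 2.

(** The hypotheses eliminate [c], x and y; what remains are polynomial identities in a, b, z, w. *)
Lemma triplication_on_curve a b c x y z w :
  on_curve a b c x y z w ->
  on_curve a b c
    (x * cn_factor a b (z ^+ 2) (w ^+ 2)) (y * dn_factor a b (z ^+ 2) (w ^+ 2))
    (z * sn_factor a b (z ^+ 2) (w ^+ 2)) (w * den_factor a b (z ^+ 2) (w ^+ 2)).
Proof.
move=> [Ex Ey]; split.
- rewrite exprMn mulrA Ex /cn_factor /sn_factor /den_factor; ring.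
- rewrite exprMn mulrA Ey /dn_factor /sn_factor /den_factor; ring.
Qed.

(** Squaring and adding the two curve equations cancels the cross terms in z^2 w^2 and leaves (a^2 +
    b^2) (z^4 + w^4). The common factor m^4 + 1 is kept, as [R] may have zero divisors. *)
Lemma on_curve_quartic m x y z w :
  on_curve (m ^+ 2 + 1) (m ^+ 2 - 1) (m ^+ 4 + 1) x y z w ->
  (m ^+ 4 + 1) * ((m ^+ 4 + 1) * (x ^+ 4 + y ^+ 4))
  = (m ^+ 4 + 1) * (2 * (z ^+ 4 + w ^+ 4)).
Proof.
move=> [Ex Ey].
transitivity (((m ^+ 4 + 1) * x ^+ 2) ^+ 2 + ((m ^+ 4 + 1) * y ^+ 2) ^+ 2).
  by ring.
by rewrite Ex Ey; ring.
Qed.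

End Triplication.

Section Morphism.

Variables (R S : comNzRingType) (f : {rmorphism R -> S}) (a b Z W : R).

Let rmorphE :=
  (rmorphD f, rmorphB f, rmorphN f, rmorphM f, rmorphXn f, rmorph_nat f).

Lemma rmorph_sn_factor :
  f (sn_factor a b Z W) = sn_factor (f a) (f b) (f Z) (f W).
Proof. by rewrite /sn_factor !rmorphE. Qed.

Lemma rmorph_cn_factor :
  f (cn_factor a b Z W) = cn_factor (f a) (f b) (f Z) (f W).
Proof. by rewrite /cn_factor !rmorphE. Qed.

Lemma rmorph_dn_factor :
  f (dn_factor a b Z W) = dn_factor (f a) (f b) (f Z) (f W).
Proof. by rewrite /dn_factor !rmorphE. Qed.

Lemma rmorph_den_factor :
  f (den_factor a b Z W) = den_factor (f a) (f b) (f Z) (f W).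
Proof. by rewrite /den_factor !rmorphE. Qed.

End Morphism.

Definition triple (q : quadruple) : quadruple :=
  let a : {poly int} := 'X^2 + 1 in let b : {poly int} := 'X^2 - 1 in
  let Z := qz q ^+ 2 in let W := qw q ^+ 2 in
  Quadruple (qx q * cn_factor a b Z W) (qy q * dn_factor a b Z W)
            (qz q * sn_factor a b Z W) (qw q * den_factor a b Z W).

Definition solution (n : nat) : quadruple := iter n triple (Quadruple 1 1 'X 1).

Lemma horner_triple q (m : int) :
  let a := m ^+ 2 + 1 in let b := m ^+ 2 - 1 in
  let Z := (qz q).[m] ^+ 2 in let W := (qw q).[m] ^+ 2 in
  [/\ (qx (triple q)).[m] = (qx q).[m] * cn_factor a b Z W,
      (qy (triple q)).[m] = (qy q).[m] * dn_factor a b Z W,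
      (qz (triple q)).[m] = (qz q).[m] * sn_factor a b Z W &
      (qw (triple q)).[m] = (qw q).[m] * den_factor a b Z W].
Proof.
have Ea : horner_eval m ('X^2 + 1) = m ^+ 2 + 1.
  by rewrite /horner_eval hornerD hornerXn hornerC.
have Eb : horner_eval m ('X^2 - 1) = m ^+ 2 - 1.
  by rewrite /horner_eval hornerD hornerN hornerXn hornerC.
have Esqr (p : {poly int}) : horner_eval m (p ^+ 2) = p.[m] ^+ 2.
  exact: rmorphXn.
rewrite -Ea -Eb -!Esqr; split; rewrite hornerM; congr (_ * _).
- exact: (rmorph_cn_factor (horner_eval m)).
- exact: (rmorph_dn_factor (horner_eval m)).
- exact: (rmorph_sn_factor (horner_eval m)).
- exact: (rmorph_den_factor (horner_eval m)).
Qed.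

Lemma solution_on_curve n m :
  on_curve (m ^+ 2 + 1) (m ^+ 2 - 1) (m ^+ 4 + 1)
    (qx (solution n)).[m] (qy (solution n)).[m]
    (qz (solution n)).[m] (qw (solution n)).[m].
Proof.
elim: n => [|n IHn].
  rewrite /solution; cbn [iter qx qy qz qw].
  by rewrite hornerX hornerC; split; ring.
have [-> -> -> ->] := horner_triple (solution n) m.
exact: triplication_on_curve IHn.
Qed.

Lemma solution_quartic n m :
  quartic_equation m (qx (solution n)).[m] (qy (solution n)).[m]
    (qz (solution n)).[m] (qw (solution n)).[m].
Proof.
have m4_ge0 : 0 <= m ^+ 4 by rewrite (exprM m 2 2) sqr_ge0.
have c0 : m ^+ 4 + 1 != 0 by rewrite gt_eqF // ltr_wpDl.
have /(mulfI c0) := on_curve_quartic (solution_on_curve n m).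
rewrite /quartic_equation.
move: (_ + 1) (_ ^+ 4 + _ ^+ 4) (_ ^+ 4 + _ ^+ 4) => c t s E.
by rewrite mulrA -intrM [s * c]mulrC E intrM mulrC mulKf.
Qed.

(** At m = 3, a b = 80 is prime to 3 and 3 divides z, so [sn_factor] is 3 (80 w^8 + 3 k) and
    [den_factor] is 80 w^8 + 3 k': each step raises the valuation of z by exactly one and keeps w a
    unit. *)
Lemma solution_at3 n :
  (exists2 u : int, (qz (solution n)).[3] = 3 ^+ n.+1 * u & coprimez 3 u)
  /\ coprimez 3 (qw (solution n)).[3].
Proof.
elim: n => [|n [[u Eu cu] cw]].
  rewrite /solution; cbn [iter qz qw].
  by rewrite hornerX hornerC; split=> //; exists 1.
have [_ _ -> ->] := horner_triple (solution n) 3.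
move: (qw _).[3] cw => w cw; rewrite Eu.
have coprime_shift (s t : int) : coprimez 3 (s + 3 * t) = coprimez 3 s.
  by rewrite /coprimez addrC mulrC gcdzMDl.
have cw8 : coprimez 3 (80 * w ^+ 8) by rewrite coprimezMr coprimezXr.
have -> : 3 ^+ 2 + 1 = 10 :> int by [].
have -> : 3 ^+ 2 - 1 = 8 :> int by [].
have E3 : 3 ^+ n.+2 = 3 * (3 * 3 ^+ n) :> int by rewrite !exprS.
rewrite E3 exprS; move: (3 ^+ n) => p; split.
  (* This is u times [sn_factor] / 3, expanded with z = 3 p u. *)
  exists (u * (80 * w ^+ 8 + 3 * (- 144 * (p * u) ^+ 2 * w ^+ 6
           - 160 * 27 * (p * u) ^+ 4 * w ^+ 4 - 80 * 3 ^+ 6 * (p * u) ^+ 8))).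
    by rewrite /sn_factor; ring.
  by rewrite coprimezMr cu coprime_shift.
rewrite coprimezMr cw /=.
rewrite (_ : den_factor _ _ _ _ = 80 * w ^+ 8 + 3 * (160 * 81 * (p * u) ^+ 4 * w ^+ 4
  - 48 * 729 * (p * u) ^+ 6 * w ^+ 2 - 80 * 3 ^+ 8 * (p * u) ^+ 8)).
  by rewrite coprime_shift.
rewrite /den_factor; ring.
Qed.

Lemma toQm_inj : injective toQm.
Proof.
move=> p q /eqP; rewrite /toQm tofrac_eq => /eqP.
apply: map_inj_poly; [exact: intr_inj | exact: rmorph0].
Qed.

(** Cross-multiplication eliminates lambda and leaves an identity in Z[m], which can be evaluated at
    m = 3. *)
Lemma proportional_zw q q' :
  proportional q q' -> qz q' * qw q = qz q * qw q'.
Proof.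
move=> [l [_ _ _ Ez Ew]]; apply: toQm_inj.
have toQmM p r : toQm (p * r) = toQm p * toQm r by rewrite /toQm !rmorphM.
by rewrite !toQmM Ez Ew; ring.
Qed.

Lemma solution_zw_lt i j :
  (i < j)%N ->
  qz (solution j) * qw (solution i) <> qz (solution i) * qw (solution j).
Proof.
move=> lt_ij /(congr1 (horner^~ 3)); rewrite !hornerM.
have [[u -> cu] _] := solution_at3 i.
have [[v -> _] cw] := solution_at3 j.
have -> : 3 ^+ j.+1 = 3 ^+ i.+1 * (3 * 3 ^+ (j - i.+1)) :> int.
  by rewrite -exprS -exprD addnS subnKC.
rewrite -!mulrA.
(* Once 3^(i+1) is cancelled, the left side still has a factor 3, while the right side is prime to
   3. *)
move/(mulfI (expf_neq0 _ (isT : 3 != 0 :> int))) => E.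
have : coprimez 3 (u * (qw (solution j)).[3]) by rewrite coprimezMr cu.
by rewrite -E coprimezMr.
Qed.

Theorem theorem2 :
  exists q : nat -> quadruple,
    (forall i : nat, parametric_solution (q i)) /\
    (forall i j : nat, i <> j -> ~ proportional (q i) (q j)).
Proof.
exists solution; split=> [i | i j /eqP ne_ij /proportional_zw E].
  split=> [E | m _]; last exact: solution_quartic.
  (* The zero quadruple is excluded because w(3) is prime to 3. *)
  by have [_] := solution_at3 i; rewrite E horner0.
by case: (ltngtP i j) ne_ij => // [lt _ | gt _];
  [apply: (solution_zw_lt lt) | apply: (solution_zw_lt gt)].
Qed.
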